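(* Let $G$ be the infinite square grid, with vertex set $\mathbb{Z}\times\mathbb{Z}$, where two vertices $(u_1,u_2),(v_1,v_2)$ are adjacent iff $|u_1-v_1|+|u_2-v_2|=1$. For $k\geq 1$ let $\lambda_k$ be the $L(k,k-1,\ldots,2,1)$-labeling number of $G$. Then \[ \lambda_k \geq \begin{cases} \frac{2}{3}p(p+1)(2p+1)+2 & \text{if } k=2p \text{ is even},\\ \frac{2}{3}p(p+1)(2p+3)+2 & \text{if } k=2p+1 \text{ is odd}.\end{cases} \]
   Context: The graph distance $d(u,v)$ between vertices $u=(u_1,u_2)$ and $v=(v_1,v_2)$ of the square grid is the Manhattan distance $|u_1-v_1|+|u_2-v_2|$. For fixed $k,\lambda\in\mathbb{Z}^+$, a $\lambda$-$L(k,k-1,\ldots,2,1)$-labeling of a graph $G=(V,E)$ is a map $f:V\to\{0,1,\ldots,\lambda-1\}$ such that $|f(x)-f(y)|\geq k+1-d(x,y)$ for all distinct $x,y\in V$ (so adjacent vertices get labels differing by at least $k$, vertices at distance $2$ by at least $k-1$, ..., vertices at distance $k$ by at least $1$, and vertices at distance $\geq k+1$ are unconstrained). The $L(k,k-1,\ldots,2,1)$-labeling number $\lambda_k$ of $G$ is the smallest $\lambda$ for which a $\lambda$-$L(k,k-1,\ldots,2,1)$-labeling of $G$ exists. *)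

(* Defs.v *)
From mathcomp Require Import all_boot all_order all_algebra.
From mathcomp Require Import boolp zify.

Set Implicit Arguments.
Unset Strict Implicit.
Unset Printing Implicit Defensive.

Import Order.TTheory GRing.Theory Num.Theory.

(* A graph is given by its adjacency relation [e] on a possibly infinite
   vertex type.  The distance is a relation rather than a function, so that two
   vertices in different components simply have no distance. *)
Definition is_graph_dist (V : eqType) (e : rel V) (u v : V) (d : nat) : Prop :=
  (exists p : seq V, [/\ path e u p, last u p = v & size p = d]) /\
  (forall p : seq V, path e u p -> last u p = v -> d <= size p).

(* The subtraction [k.+1 - d] is truncated: for d >= k + 1 there is no
   constraint. The difference of labels is taken in int. *)
Definition is_labeling (V : eqType) (e : rel V) (k l : nat) (f : V -> 'I_l) :
    Prop :=
  forall (x y : V) (d : nat), x <> y -> is_graph_dist e x y d ->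
    k.+1 - d <= `|(Posz (f x) - Posz (f y))%R|%N.

Definition has_labeling (V : eqType) (e : rel V) (k l : nat) : Prop :=
  exists f : V -> 'I_l, is_labeling e k f.

Definition manhattan (u v : int * int) : nat :=
  `|(u.1 - v.1)%R|%N + `|(u.2 - v.2)%R|%N.

Definition grid_adj : rel (int * int) := fun u v => manhattan u v == 1.

Lemma manhattan_le_path (u : int * int) (p : seq (int * int)) :
  path grid_adj u p -> manhattan u (last u p) <= size p.
Proof.
elim: p u => [|w p IH] u /=; first by move=> _; rewrite /manhattan; lia.
move=> /andP[/eqP uw /IH]; move: uw; rewrite /manhattan; lia.
Qed.

Lemma grid_dist_manhattan (u v : int * int) :
  is_graph_dist grid_adj u v (manhattan u v).
Proof.
split; last by move=> p pp <-; exact: manhattan_le_path.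
have [n] := ubnP (manhattan u v); elim: n u => // n IH u lt_n.
have [uv0|uv_gt0] := posnP (manhattan u v).
  exists [::]; split=> //=.
  case: u v uv0 {IH lt_n} => [a b] [c d]; rewrite /manhattan /= => uv0.
  by congr pair; lia.
have [w [uw wv]] : exists w, grid_adj u w /\ manhattan u v = (manhattan w v).+1.
  case: u v uv_gt0 {IH lt_n} => [a b] [c d]; rewrite /grid_adj /manhattan /= => gt0.
  have [lt_ac|le_ca] := ltP a c.
    by exists ((a + 1)%R, b) => /=; split; [apply/eqP|]; lia.
  have [lt_ca|le_ac] := ltP c a.
    by exists ((a - 1)%R, b) => /=; split; [apply/eqP|]; lia.
  have [lt_bd|le_db] := ltP b d.
    by exists (a, (b + 1)%R) => /=; split; [apply/eqP|]; lia.
  by exists (a, (b - 1)%R) => /=; split; [apply/eqP|]; lia.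
have [|p [pp pv ps]] := IH w; first by lia.
by exists (w :: p) => /=; split; rewrite ?uw ?ps ?wv.
Qed.

Lemma grid_has_labeling (k : nat) : exists l, has_labeling grid_adj k l.
Proof.
pose r (m : int) : nat := `|(m %% Posz k.+1)%Z|%N.
have rE m : exists q, (m = q * Posz k.+1 + Posz (r m))%R.
  exists (m %/ Posz k.+1)%Z; rewrite {1}(divz_eq m (Posz k.+1)); congr (_ + _)%R.
  by rewrite /r gez0_abs // modz_ge0.
have r_lt m : r m < k.+1.
  by rewrite -ltz_nat /r gez0_abs ?modz_ge0 // ltz_pmod.
have far (m n : int) : r m = r n -> `|(m - n)%R|%N < k.+1 -> m = n.
  have [q Em] := rE m; have [q' En] := rE n => e lt_k.
  suff qq' : q = q' by rewrite Em En qq' e.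
  move: lt_k; rewrite Em En e opprD addrACA subrr addr0 -mulrBl abszM.
  have [//|/eqP neq] := eqVneq q q'; rewrite absz_nat => lt_k.
  have q_gt0 : 0 < `|(q - q')%R|%N by lia.
  by move: lt_k; rewrite ltnNge leq_pmull.
pose g (u : int * int) : nat := k * (r u.1 + k.+1 * r u.2).
have g_lt u : g u < (k * (k + k.+1 * k)).+1.
  by rewrite ltnS leq_mul ?leq_add ?leq_mul // -ltnS.
exists (k * (k + k.+1 * k)).+1, (fun u => Ordinal (g_lt u)).
move=> x y d neq [[p [pp py <-]] _] /=.
have := manhattan_le_path pp; rewrite py => le_d.
have d_gt0 : 0 < size p by case: p py {pp le_d} => // /neq.
have [big|near] := leqP k.+1 (size p).
  by move: big; rewrite -subn_eq0 => /eqP ->.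
have [e|ne] := eqVneq (r x.1 + k.+1 * r x.2) (r y.1 + k.+1 * r y.2); last first.
  rewrite /g !PoszM -mulrBr abszM absz_nat; apply: (@leq_trans k).
    by rewrite leq_subLR -add1n leq_add2r.
  by rewrite leq_pmulr // absz_gt0 subr_eq0 eqz_nat.
exfalso; apply: neq.
have e2 : r x.2 = r y.2.
  have := congr1 (divn^~ k.+1) e.
  by rewrite /= ![_ + _ * _]addnC !(mulnC k.+1) !divnMDl // !divn_small ?addn0.
have e1 : r x.1 = r y.1 by move: e; rewrite e2 => /addIn.
have := leq_ltn_trans le_d near; rewrite /manhattan => {}le_d.
case: x y le_d e1 e2 {e py pp} => [a b] [a' b'] /= le_d e1 e2.
by congr pair; apply: far => //; lia.
Qed.

Lemma grid_has_labelingb (k : nat) :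
  exists l, `[< has_labeling grid_adj k l >].
Proof. by have [l hl] := grid_has_labeling k; exists l; apply/asboolP. Qed.

Definition lambda (k : nat) : nat := ex_minn (grid_has_labelingb k).

Lemma lambdaP (k : nat) :
  has_labeling grid_adj k (lambda k) /\
  (forall l, has_labeling grid_adj k l -> lambda k <= l).
Proof.
rewrite /lambda; case: ex_minnP => m /asboolP hm min_m.
by split=> // l hl; apply: min_m; apply/asboolP.
Qed.

(* Main.v *)
Require Import Defs.
From mathcomp Require Import all_boot all_order all_algebra.
From mathcomp Require Import zify lra.

Import GRing.Theory Num.Theory.

(** List the n = 2p(p+1)+1 vertices of the ball of radius p around the origin in
    increasing order of label. Consecutive labels of vertices x, y differ by at
    least k+1-d(x,y), and d(x,y) <= |x|+|y|. Telescoping, the labels of the ball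
    span at least (n-1)(k+1) - 2 * sum |x| + |first| + |last|; the first and last
    vertices are distinct, so |first| + |last| >= 1. *)

Local Open Scope ring_scope.

(** Summing the gaps along the path, an interior weight enters two gaps and an end weight only one;
    adding both end weights on the left completes the sum to twice the total weight. All terms are
    moved to the side where they are added, which avoids truncated subtraction. *)
Lemma sorted_path_span (T : eqType) (f w : T -> nat) (K : nat) (x : T) (s : seq T) :
  (forall y z : T, y != z -> (f y <= f z)%N -> (K + f y <= f z + (w y + w z))%N) ->
  path (fun y z => (f y <= f z)%N) x s -> uniq (x :: s) ->
  (f x + size s * K + w x + w (last x s)
     <= f (last x s) + 2 * \sum_(y <- x :: s) w y)%N.
Proof.
move=> gap; elim: s x => [|y s IH] x /=; first by rewrite big_seq1; lia.
case/andP=> le_xy ys /andP[].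
rewrite inE negb_or => /andP[neq_xy _] uys.
have := IH y ys uys; have := gap x y neq_xy le_xy.
rewrite [(\sum_(z <- x :: _) _)%N]big_cons mulSn; lia.
Qed.

(** The four sides of the diamond of radius [j], counterclockwise from [(j, 0)]. Each side is
    half-open, so every corner is listed once; for [j = 0] the list is empty, hence the separate
    base case of [ball]. *)
Definition sphere (j : nat) : seq (int * int) :=
  [seq (Posz j - Posz i, Posz i) | i <- iota 0 j] ++
  [seq (- Posz i, Posz j - Posz i) | i <- iota 0 j] ++
  [seq (Posz i - Posz j, - Posz i) | i <- iota 0 j] ++
  [seq (Posz i, Posz i - Posz j) | i <- iota 0 j].

Fixpoint ball (p : nat) : seq (int * int) :=
  if p is q.+1 then sphere p ++ ball q else [:: (0, 0)].

Lemma ballS (p : nat) : ball p.+1 = sphere p.+1 ++ ball p.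
Proof. by []. Qed.

Local Notation norm := (manhattan (0, 0)).

Lemma norm_sphere (j : nat) (u : int * int) : u \in sphere j -> norm u = j.
Proof.
rewrite !mem_cat /manhattan => /or4P[] /mapP[i]; rewrite mem_iota => lt_ij -> /=; lia.
Qed.

Lemma norm_ball (p : nat) (u : int * int) : u \in ball p -> (norm u <= p)%N.
Proof.
elim: p => [|p IH]; first by rewrite inE => /eqP->.
by rewrite ballS mem_cat => /orP[/norm_sphere->|/IH/leqW].
Qed.

Lemma size_sphere (j : nat) : size (sphere j) = (4 * j)%N.
Proof. rewrite !size_cat !size_map size_iota; lia. Qed.

Lemma sphere_uniq (j : nat) : uniq (sphere j).
Proof.
rewrite !cat_uniq !map_inj_uniq ?iota_uniq //=;
  try by move=> a b [] *; lia.
rewrite andbT; apply/and3P; split; apply/hasPn=> u; rewrite ?mem_cat.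
- by move=> hu; apply/mapP=> -[i']; rewrite mem_iota => hi' E; move: hu;
    case/or3P=> /mapP[i]; rewrite mem_iota E => hi [] *; lia.
- by move=> hu; apply/mapP=> -[i']; rewrite mem_iota => hi' E; move: hu;
    case/orP=> /mapP[i]; rewrite mem_iota E => hi [] *; lia.
- by move=> hu; apply/mapP=> -[i']; rewrite mem_iota => hi' E; move: hu;
    case/mapP=> i; rewrite mem_iota E => hi [] *; lia.
Qed.

Lemma ball_uniq (p : nat) : uniq (ball p).
Proof.
elim: p => [//|p IH]; rewrite ballS cat_uniq sphere_uniq IH andbT.
apply/hasPn=> u /norm_ball le_u; apply/negP=> /norm_sphere; lia.
Qed.

Lemma size_ball (p : nat) : size (ball p) = (2 * p * p.+1).+1.
Proof. elim: p => [//|p IH]; rewrite ballS size_cat size_sphere IH; lia. Qed.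

(** The sphere of radius [j] contributes [4 * j ^ 2]; the factor 3 clears the denominator in the
    formula for a sum of squares. *)
Lemma sum_norm_ball (p : nat) :
  (3 * \sum_(u <- ball p) norm u = 2 * p * p.+1 * (2 * p).+1)%N.
Proof.
elim: p => [|p IH]; first by rewrite big_seq1.
rewrite ballS big_cat /= mulnDr IH big_seq.
rewrite (eq_bigr (fun=> p.+1)) => [|u /norm_sphere //].
rewrite -big_seq big_const_seq count_predT iter_addn_0 size_sphere; lia.
Qed.

Lemma is_labeling_grid (k l : nat) (f : int * int -> 'I_l) (u v : int * int) :
  is_labeling grid_adj k f -> u != v ->
  (k.+1 - manhattan u v <= `|(Posz (f u) - Posz (f v))%R|)%N.
Proof.
by move=> fL /eqP neq_uv; apply: fL neq_uv _; apply: grid_dist_manhattan.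
Qed.

Lemma labeling_ball_bound (k l p : nat) :
  (0 < p)%N -> has_labeling grid_adj k l ->
  (2 * p * p.+1 * k.+1 + 2 <= l + 2 * \sum_(u <- ball p) norm u)%N.
Proof.
move=> p_gt0 [f fL].
pose le u v := (f u <= f v)%N.
have le_total : total le by move=> u v; apply: leq_total.
have := sort_sorted le_total (ball p); have := sort_uniq le (ball p).
have := size_sort le (ball p); have := permEl (perm_sort le (ball p)).
case: (sort le (ball p)) => [|x s] perm_s; first by rewrite size_ball.
rewrite size_ball ball_uniq -(perm_big _ perm_s) => -[size_s] uniq_s sorted_s.
have gap u v : u != v -> (f u <= f v)%N ->
    (k.+1 + f u <= f v + (norm u + norm v))%N.
  move=> /(is_labeling_grid _ _ _ _ _ fL); rewrite /manhattan /=; lia.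
have := @sorted_path_span _ (fun u => f u : nat) norm _ _ _ gap sorted_s uniq_s.
have : (0 < norm x + norm (last x s))%N.
  (* As [0 < p], the list has more than one entry, so its ends differ and cannot both be the origin,
     the only point of norm 0. *)
  case: s uniq_s size_s {perm_s sorted_s} => [|y s] /=; first by move=> _; lia.
  move=> /andP[x_notin _] _; have : x != last y s.
    by apply: contraNneq x_notin => ->; apply: mem_last.
  case: x {x_notin} (last y s) => [a b] [c d]; rewrite /manhattan /= => neq.
  rewrite lt0n; apply: contraNneq neq => E; apply/eqP; congr pair; lia.
(* The constant 2 arises here: one unit from the end norms, one from labels being at most
   [l - 1]. *)
have := ltn_ord (f (last x s)); rewrite size_s /=; lia.
Qed.

Lemma lambda_ball_bound (k p : nat) : (1 <= k)%N ->
  (6 * p * p.+1 * k.+1 + 6 <= 3 * lambda k + 4 * p * p.+1 * (2 * p).+1)%N.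
Proof.
move=> k_gt0; have [lab _] := lambdaP k.
case: (posnP p) => [->|p_gt0].
  (* The ball of radius 0 is a single vertex, so the bound [2 <= lambda k] is read off two adjacent
     vertices, whose labels differ by at least [k >= 1]. *)
  have [f fL] := lab.
  have := is_labeling_grid _ _ _ (0, 0) (0, 1) fL isT.
  have := ltn_ord (f (0, 0)); have := ltn_ord (f (0, 1)).
  rewrite /manhattan /=; lia.
have := labeling_ball_bound _ _ _ p_gt0 lab; have := sum_norm_ball p; lia.
Qed.

Theorem theorem1 (k : nat) (hk : (1 <= k)%N) :
  (forall p : nat, k = (2 * p)%N ->
     (2%:R / 3%:R * p%:R * (p%:R + 1) * (2%:R * p%:R + 1) + 2%:R : rat)
       <= (lambda k)%:R)
  /\
  (forall p : nat, k = (2 * p + 1)%N ->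
     (2%:R / 3%:R * p%:R * (p%:R + 1) * (2%:R * p%:R + 3%:R) + 2%:R : rat)
       <= (lambda k)%:R).
Proof.
split=> p Ek; have := lambda_ball_bound k p hk.
(* Only the [k] in [k.+1] is replaced, so [lambda k] stays intact. *)
- move=> B; have {B} : (2 * p * (p + 1) * (2 * p + 1) + 6 <= 3 * lambda k)%N.
    by rewrite {1}Ek in B; lia.
  rewrite -(ler_nat rat) !(natrD, natrM); lra.
(* With [k.+1 = 2 * p + 2], [B] even yields [2 * p * (p + 1) * (2 * p + 4) + 6 <= 3 * lambda k],
   which is then weakened. *)
- move=> B; have {B} : (2 * p * (p + 1) * (2 * p + 3) + 6 <= 3 * lambda k)%N.
    by rewrite {1}Ek in B; lia.
  rewrite -(ler_nat rat) !(natrD, natrM); lra.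
Qed.
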